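(* Let $n,k\ge 1$ be integers, let $A\in\mathbb{M}(n)$, and let $\otimes^k:\mathbb{M}(n)\to\mathbb{M}(n^k)$ be the map $A\mapsto\otimes^k A$. For every $1\le m\le k$ and all $X^1,\ldots,X^m\in\mathbb{M}(n)$, $$\mathrm{D}^m\otimes^k(A)(X^1,\ldots,X^m)=\sum_{\sigma\in S_m}\ \sum_{\substack{j_i\ge 0\\ j_1+\cdots+j_{m+1}=k-m}}(\otimes^{j_1}A)\otimes X^{\sigma(1)}\otimes(\otimes^{j_2}A)\otimes X^{\sigma(2)}\otimes\cdots\otimes(\otimes^{j_m}A)\otimes X^{\sigma(m)}\otimes(\otimes^{j_{m+1}}A),$$ where the inner sum runs over all tuples $(j_1,\ldots,j_{m+1})$ of nonnegative integers with $j_1+\cdots+j_{m+1}=k-m$.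
   Context: $\mathbb{M}(n)$ denotes the space of $n\times n$ complex matrices, identified with the linear operators on $\mathcal{H}=\mathbb{C}^n$. The $k$-fold tensor power $\otimes^k\mathcal{H}$ is an $n^k$-dimensional Hilbert space with inner product determined by $\langle x_1\otimes\cdots\otimes x_k,y_1\otimes\cdots\otimes y_k\rangle=\prod_{i=1}^k\langle x_i,y_i\rangle$. For an orthonormal basis $e_1,\ldots,e_n$ of $\mathcal{H}$, the basis $\{e_{i_1}\otimes\cdots\otimes e_{i_k}\}$ of $\otimes^k\mathcal{H}$ is ordered lexicographically, and operators on $\otimes^k\mathcal{H}$ are thereby identified with $\mathbb{M}(n^k)$ (tensor products of matrices are Kronecker products). The tensor power $\otimes^k A$ is the operator determined by $(\otimes^k A)(x_1\otimes\cdots\otimes x_k)=Ax_1\otimes\cdots\otimes Ax_k$; a factor $\otimes^{0}A$ in a tensor product is simply omitted (i.e. it is the scalar $1$). $S_m$ is the set of all permutations of $\{1,\ldots,m\}$. For an $m$-times differentiable map $f$ between Banach spaces, $\mathrm{D}^m f(a)$ is the $m$th derivative of $f$ at $a$, regarded as a continuous $m$-linear map; it satisfies $$\mathrm{D}^m f(a)(x^1,\ldots,x^m)=\left.\frac{\partial^m}{\partial t_1\cdots\partial t_m}\right|_{t_1=\cdots=t_m=0}f(a+t_1x^1+\cdots+t_mx^m).$$ $\mathrm{D}^m\otimes^k(A)$ denotes the $m$th derivative at $A$ of the map $\otimes^k$. *)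

(* Defs.v *)
From HB Require Import structures.
From mathcomp Require Import all_boot all_order all_fingroup all_algebra.
From mathcomp Require Import complex mxtens.
From mathcomp Require Import all_classical all_reals all_analysis.

Set Implicit Arguments.
Unset Strict Implicit.
Unset Printing Implicit Defensive.

Import Order.TTheory GRing.Theory Num.Theory.
Import numFieldNormedType.Exports.

Local Open Scope classical_set_scope.
Local Open Scope ring_scope.

Section NthFrechetDerivative.
Variables (K : numFieldType) (V W : normedModType K).

Definition arg_cons (m : nat) (h : V) (x : 'I_m -> V) : 'I_m.+1 -> V :=
  fun i => if unlift ord0 i is Some i' then x i' else h.

Definition multilinear (m : nat) (L : ('I_m -> V) -> W) : Prop :=
  forall (x : 'I_m -> V) (i : 'I_m),
    linear (fun v : V => L (dfwith x i v)).

(* For multilinear maps between normed spaces, boundedness is continuity. *)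
Definition continuous_multilinear (m : nat) (L : ('I_m -> V) -> W) : Prop :=
  multilinear L /\
  exists M : K, forall x : 'I_m -> V, `|L x| <= M * \prod_(i < m) `|x i|.

(* The Frechet derivative at a of a map F from V to the space of continuous  *)
(* m-linear maps equipped with the norm                                      *)
(* |T| = sup { `|T x| : `|x i| <= 1 for all i },                             *)
(* where a continuous linear map from V to that space is identified with a   *)
(* continuous (m+1)-linear map; the last condition says                      *)
(* |F (a + h) - F a - L (h, -)| = o(`|h|) as h tends to 0.                   *)
Definition is_multilinear_derivative (m : nat)
    (F : V -> ('I_m -> V) -> W) (a : V) (L : ('I_m.+1 -> V) -> W) : Prop :=
  continuous_multilinear L /\
  forall e : K, 0 < e -> \forall h \near (0 : V), forall x : 'I_m -> V,
    `|F (a + h) x - F a x - L (arg_cons h x)|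
      <= e * `|h| * \prod_(i < m) `|x i|.

Fixpoint is_nth_derivative (f : V -> W) (m : nat) :
    V -> (('I_m -> V) -> W) -> Prop :=
  match m return V -> (('I_m -> V) -> W) -> Prop with
  | 0 => fun a L => forall x, L x = f a
  | m'.+1 => fun a L => exists F : V -> ('I_m' -> V) -> W,
      (\forall b \near a, is_nth_derivative f b (F b)) /\
      is_multilinear_derivative F a L
  end.

Definition nth_differentiable (m : nat) (f : V -> W) (a : V) : Prop :=
  exists L : ('I_m -> V) -> W, is_nth_derivative f a L.

Lemma arg_consE m (y : 'I_m.+1 -> V) :
  y = arg_cons (y ord0) (fun i => y (lift ord0 i)).
Proof. by apply/funext => i; rewrite /arg_cons; case: unliftP => [j ->|->]. Qed.

Lemma multilinear_consZ m (L : ('I_m.+1 -> V) -> W) (c : K) h x :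
  multilinear L -> L (arg_cons (c *: h) x) = c *: L (arg_cons h x).
Proof.
move=> ml.
have E v : arg_cons v x = dfwith (arg_cons (0 : V) x) ord0 v.
  apply/funext => i; rewrite /arg_cons; case: unliftP => [j ->|->].
    by rewrite dfwithout ?neq_lift// /arg_cons liftK.
  by rewrite dfwithin.
have L0 := ml (arg_cons (0 : V) x) ord0.
have Z0 : L (arg_cons 0 x) = 0.
  have := L0 1 0 0; rewrite !scale1r addr0 -E => /eqP.
  by rewrite -[X in X == _]addr0 (inj_eq (addrI _)) eq_sym => /eqP.
by have := L0 c h 0; rewrite addr0 -!E Z0 addr0.
Qed.

Lemma is_nth_derivative_unique m (f : V -> W) (a : V)
    (L1 L2 : ('I_m -> V) -> W) :
  is_nth_derivative f a L1 -> is_nth_derivative f a L2 -> L1 = L2.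
Proof.
elim: m a L1 L2 => [|m IHm] a L1 L2 /=.
  by move=> L1E L2E; apply/funext => x; rewrite L1E L2E.
move=> [F1 [F1E [[ml1 _] dL1]]] [F2 [F2E [[ml2 _] dL2]]].
have F12 : \forall b \near a, F1 b = F2 b.
  by apply: filterS2 F1E F2E => b; exact: IHm.
have F12a : F1 a = F2 a by exact: nbhs_singleton F12.
have F12D : \forall t \near (0 : V), F1 (a + t) = F2 (a + t).
  rewrite -[a]addr0 in F12.
  have : (fun t : V => a + t) @ (0 : V) --> a + 0.
    by apply: cvgD; [exact: cvg_cst|exact: cvg_id].
  by move=> /(_ _ F12).
apply/funext => y; rewrite (arg_consE y); set x := fun i => _.
set h := y ord0; set c := `|h| * \prod_(i < m) `|x i|.
have c0 : 0 <= c by rewrite mulr_ge0// prodr_ge0.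
apply/eqP; rewrite -subr_eq0 -normr_le0; apply/ler_addgt0Pr => e e0.
rewrite add0r.
have d0 : 0 < e / (c + 1) / 2 by rewrite !divr_gt0// ltr_wpDl.
have : \forall t \near (0 : V),
    `|L1 (arg_cons t x) - L2 (arg_cons t x)|
      <= e / (c + 1) * (`|t| * \prod_(i < m) `|x i|).
  apply: filterS3 F12D (dL1 _ d0) (dL2 _ d0) => t F12t /(_ x) + /(_ x).
  rewrite F12t F12a distrC => le1 le2.
  rewrite -[L1 _](subrK (F2 (a + t) x - F2 a x)) -addrA.
  apply: le_trans (ler_normD _ _) _; apply: le_trans (lerD le1 le2) _.
  by rewrite -mulrDl -mulrDl -splitr mulrA.
move=> /nbhs_normP[r /= r0 rP].
set t := r / 2 / (`|h| + 1).
have h0 : 0 < `|h| + 1 by rewrite ltr_wpDl.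
have t0 : 0 < t by rewrite !divr_gt0.
have := rP (t *: h); rewrite /= sub0r normrN normrZ gtr0_norm//.
have -> : t * `|h| < r.
  rewrite /t mulrAC ltr_pdivrMr//.
  rewrite (le_lt_trans (y := r / 2 * (`|h| + 1)))//.
    by rewrite ler_pM2l ?divr_gt0// lerDl.
  by rewrite ltr_pM2r// ltr_pdivrMr// ltr_pMr// ltr1n.
move=> /(_ isT); rewrite !multilinear_consZ// -scalerBr normrZ gtr0_norm//.
rewrite -(mulrA t) (mulrCA _ t) ler_pM2l// => /le_trans; apply.
by rewrite -/c mulrAC ler_pdivrMr ?ltr_wpDl// ler_pM2l// lerDl.
Qed.

(* Meaningful when nth_differentiable m f a, by is_nth_derivative_unique. *)
Definition nth_derivative (m : nat) (f : V -> W) (a : V) : ('I_m -> V) -> W :=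
  get (fun L : ('I_m -> V) -> W => is_nth_derivative f a L).

End NthFrechetDerivative.

Section InterleavedTensor.
Variables (R : pzRingType) (n : nat).

Fixpoint interleave_dim (m : nat) : ('I_m.+1 -> nat) -> nat :=
  match m return ('I_m.+1 -> nat) -> nat with
  | 0 => fun j => (n ^ j ord0)%N
  | m'.+1 => fun j =>
      (n ^ j ord0 * (n * interleave_dim (fun i => j (lift ord0 i))))%N
  end.

(* A ^t j_0 *t (Y_0 *t (A ^t j_1 *t (... *t (Y_(m-1) *t A ^t j_m)))) *)
Fixpoint interleave_rec (A : 'M[R]_n) (m : nat) :
    forall (j : 'I_m.+1 -> nat) (Y : 'I_m -> 'M[R]_n),
      'M[R]_(interleave_dim j) :=
  match m return forall (j : 'I_m.+1 -> nat) (Y : 'I_m -> 'M[R]_n),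
      'M[R]_(interleave_dim j) with
  | 0 => fun j _ => A ^t j ord0
  | m'.+1 => fun j Y =>
      A ^t j ord0 *t
        (Y ord0 *t interleave_rec A (fun i => j (lift ord0 i))
                                    (fun i => Y (lift ord0 i)))
  end.

Lemma interleave_dimE (m : nat) (j : 'I_m.+1 -> nat) :
  interleave_dim j = (n ^ (\sum_i j i + m))%N.
Proof.
elim: m j => [|m IHm] j /=; first by rewrite big_ord1 addn0.
by rewrite IHm -expnS -expnD [in RHS]big_ord_recl !addnS addnA.
Qed.

(* By interleave_conformE, the default value 0 is never used when            *)
(* j_0 + ... + j_m = k - m.                                                  *)
Definition interleave (k : nat) (A : 'M[R]_n) (m : nat)
    (j : 'I_m.+1 -> nat) (Y : 'I_m -> 'M[R]_n) : 'M[R]_(n ^ k) :=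
  conform_mx 0 (interleave_rec A j Y).

Lemma interleave_conformE (k m : nat) (A : 'M[R]_n) (j : 'I_m.+1 -> nat)
    (Y : 'I_m -> 'M[R]_n) (dimE : interleave_dim j = (n ^ k)%N) :
  interleave k A j Y = castmx (dimE, dimE) (interleave_rec A j Y).
Proof.
rewrite /interleave.
by move: (interleave_rec A j Y); case: _ / dimE => B; rewrite conform_mx_id.
Qed.

End InterleavedTensor.

Definition tensor_power (R : pzRingType) (n k : nat) (A : 'M[R]_n) :
  'M[R]_(n ^ k) := A ^t k.

(* Main.v *)
Require Import Defs.
From HB Require Import structures.
From mathcomp Require Import all_boot all_order all_fingroup all_algebra.
From mathcomp Require Import complex mxtens.
From mathcomp Require Import all_classical all_reals all_analysis.
From mathcomp Require Import zify ring.

(** Expanding a k-fold tensor power of A + h shows the shape of the answer: a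
  derivative of order m replaces m of the k factors A by directions.  The proof
  organises these replacements by the order in which the directions occur.  For
  a word Y_0 ... Y_(m-1) of matrices, [tens_shuffle A k Y] is the sum of all
  k-fold tensor products in which the letters of Y occur once each, in this
  order, all other factors being A.  Looking at the first factor, which is
  either A or Y_0, gives

    Q (k+1) Y = A (x) Q k Y + Y_0 (x) Q k (Y_1 ... Y_(m-1)),

  with Q := tens_shuffle A, and everything is proved by induction on k along
  this recursion.

  Analysis.  By the Leibniz rule, the derivative of A |-> Q k Y in the direction
  h is the sum of the Q k Y', where Y' runs over the m+1 words obtained by
  inserting h somewhere in Y ([tens_shuffle_diff]).  The remainder satisfies a
  recursion of the same kind ([tens_shuffle_remS]) and is thus bounded by
  C |h|^2 |Y_0| ... |Y_(m-1)| ([normr_tens_shuffle_rem]); the product of the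
  norms is what makes the estimate one in the norm of multilinear maps.  Every
  arrangement of h, X_0, ..., X_(m-1) is obtained in exactly one way by inserting
  h in an arrangement of the X_i ([sum_perm_insert]), so that the derivative of
  the sum over S_m of the Q k (X o s) is the corresponding sum over S_(m+1).  For
  m = 0 the sum is the tensor power itself, so by induction on m the sum over S_m
  is its m-th derivative ([tens_power_is_nth_derivative]).

  Combinatorics.  A shuffle of Y with copies of A is determined by the numbers
  j_0, ..., j_m of factors A before, between and after the letters.  Splitting
  the sum over j according to whether j_0 = 0 gives back the recursion of Q
  ([sum_interleave]). *)

Import Order.TTheory GRing.Theory Num.Theory.
Import numFieldNormedType.Exports.

Local Open Scope ring_scope.

Set Implicit Arguments.
Unset Strict Implicit.
Unset Printing Implicit Defensive.

(** * Kronecker products of square matrices of arbitrary size *)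

Section Packed.
Variable R : comPzRingType.

(** The sizes p * (q * r) and (p * q) * r, or n * n ^ k and n ^ k.+1, are equal
  without being convertible.  Square matrices packed with their size form an
  honest monoid for the Kronecker product, in which casts disappear. *)
Definition packed_mx := {p : nat & 'M[R]_p}.
Definition pack {p} (B : 'M[R]_p) : packed_mx := Tagged (fun p => 'M[R]_p) B.
Definition unpack q (S : packed_mx) : 'M[R]_q := conform_mx 0 (tagged S).
Definition ptens (S T : packed_mx) : packed_mx := pack (tagged S *t tagged T).

Lemma packK p : cancel (@pack p) (unpack p).
Proof. by move=> B; exact: conform_mx_id. Qed.

Lemma pack_inj p : injective (@pack p).
Proof. exact: can_inj (@packK p). Qed.

Lemma pack_castmx p q (e : p = q) (B : 'M[R]_p) :
  pack (castmx (e, e) B) = pack B.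
Proof. by case: q / e; rewrite castmx_id. Qed.

Lemma ptensA : associative ptens.
Proof.
move=> [p B] [q C] [r D]; rewrite /ptens /=.
rewrite -(pack_castmx (mulnA p q r) (B *t (C *t D))); congr pack.
apply/matrixP=> i j; rewrite castmxE !mxE mulrA /=.
have E x : ((x %% (q * r)) %/ r = (x %/ r) %% q)%N by rewrite modn_divl.
congr (B _ _ * C _ _ * D _ _); apply: val_inj;
  by rewrite /= ?E ?[(q * r)%N]mulnC ?divnMA ?modn_dvdm ?dvdn_mulr.
Qed.

Lemma ptens1l S : ptens (pack (1%:M : 'M[R]_1)) S = S.
Proof.
by case: S => p B; rewrite /ptens /= [_ *t _]tens_scalar1mx pack_castmx.
Qed.

Lemma ptens1r S : ptens S (pack (1%:M : 'M[R]_1)) = S.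
Proof.
by case: S => p B; rewrite /ptens /= tens_mx_scalar scale1r pack_castmx.
Qed.

Lemma pack_ntensmxS n k (A : 'M[R]_n) :
  pack (A ^t k.+1) = ptens (pack A) (pack (A ^t k)).
Proof. by case: k => [|k]; rewrite ?ntensmxSS // ptens1r. Qed.

End Packed.

(** * Inserting an argument *)

Definition arg_tail (T : Type) m (Y : 'I_m.+1 -> T) : 'I_m -> T :=
  fun i => Y (lift ord0 i).

Definition arg_insert (T : Type) m (p : 'I_m.+1) (h : T) (Y : 'I_m -> T) :
  'I_m.+1 -> T := fun i => if unlift p i is Some i' then Y i' else h.

Lemma arg_insert0 T m (h : T) (Y : 'I_m -> T) :
  arg_insert ord0 h Y ord0 = h.
Proof. by rewrite /arg_insert unlift_none. Qed.

Lemma arg_tail_insert0 T m (h : T) (Y : 'I_m -> T) :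
  arg_tail (arg_insert ord0 h Y) = Y.
Proof. by apply/funext => i; rewrite /arg_tail /arg_insert liftK. Qed.

Lemma arg_insertS0 T m p (h : T) (Y : 'I_m.+1 -> T) :
  arg_insert (lift ord0 p) h Y ord0 = Y ord0.
Proof.
rewrite /arg_insert; case: unliftP => [i|/eqP] E; last by rewrite -val_eqE in E.
by congr Y; apply: val_inj; move/(congr1 val): E; rewrite /= /bump; lia.
Qed.

Lemma arg_tail_insertS T m p (h : T) (Y : 'I_m.+1 -> T) :
  arg_tail (arg_insert (lift ord0 p) h Y)
  = arg_insert p h (arg_tail Y).
Proof.
apply/funext => i; rewrite /arg_tail /arg_insert.
case: unliftP => [a|] E; case: unliftP => [b|] E'.
- congr Y; apply: val_inj; move/(congr1 val): E; rewrite E' /= /bump; lia.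
- by move/(congr1 val): E; rewrite E' /= /bump; lia.
- by move/(congr1 val): E; rewrite E' /= /bump; lia.
- by [].
Qed.

(** A permutation s of m + 1 indices amounts to the place p with s p = 0, where h
  is to go, and to the order in which s runs through the other indices; this
  is the bijection (p, s) |-> lift_perm p ord0 s. *)
Lemma sum_perm_insert (T : Type) (V : nmodType) m (h : T) (X : 'I_m -> T)
    (F : ('I_m.+1 -> T) -> V) :
  \sum_(s : 'S_m.+1) F (arg_insert ord0 h X \o s) =
  \sum_(s : 'S_m) \sum_(p < m.+1) F (arg_insert p h (X \o s)).
Proof.
rewrite exchange_big pair_big /=.
pose lp (ps : 'I_m.+1 * 'S_m) := lift_perm ps.1 ord0 ps.2.
have lp_inj : injective lp.
  move=> [p s] [q t]; rewrite /lp /= => E.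
  have pq : p = q.
    apply: (@perm_inj _ (lift_perm p ord0 s)).
    by rewrite lift_perm_id E lift_perm_id.
  congr (_, _) => //; apply/permP => i; apply: (@lift_inj _ ord0).
  by rewrite -(lift_perm_lift p) E pq lift_perm_lift.
rewrite (reindex lp) /=; last first.
  apply: onW_bij; apply: inj_card_bij => //.
  by rewrite card_prod card_ord !card_Sn factS.
apply: eq_bigr => -[p s] _; congr F; apply/funext => i /=.
rewrite /lp /arg_insert /=; case: (unliftP p i) => [j ->|->].
  by rewrite lift_perm_lift liftK.
by rewrite lift_perm_id unlift_none.
Qed.

Lemma dfwith_insert (T : Type) m (x : 'I_m.+1 -> T) i v :
  dfwith x i v = arg_insert i v (fun j => x (lift i j)).
Proof.
apply/funext => j; rewrite /arg_insert; case: unliftP => [a ->|->].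
  by rewrite dfwithout // neq_lift.
by rewrite dfwithin.
Qed.

Lemma dfwith_perm (T : Type) m (x : 'I_m -> T) i v (s : 'S_m) :
  dfwith x i v \o s = dfwith (x \o s) (s^-1 i)%g v.
Proof.
apply/funext => j /=; have [->|ne] := eqVneq j (s^-1 i)%g.
  by rewrite permKV !dfwithin.
by rewrite !dfwithout //= 1?eq_sym //; apply: contraNneq ne => <-; rewrite permK.
Qed.

(** * Shuffles of a word of matrices with copies of a matrix *)

Section Shuffle.
Variables (R : comPzRingType) (n : nat).
Implicit Types A B : 'M[R]_n.

Definition tens_cons {k} B (C : 'M[R]_(n ^ k)) : 'M[R]_(n ^ k.+1) :=
  castmx (esym (expnS n k), esym (expnS n k)) (B *t C).

Lemma pack_tens_cons k B (C : 'M[R]_(n ^ k)) :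
  pack (tens_cons B C) = ptens (pack B) (pack C).
Proof. exact: pack_castmx. Qed.

Lemma tens_consDl k A B (C : 'M[R]_(n ^ k)) :
  tens_cons (A + B) C = tens_cons A C + tens_cons B C.
Proof. by apply/matrixP=> i j; rewrite !(castmxE, mxE) mulrDl. Qed.

Lemma tens_consDr k A (B C : 'M[R]_(n ^ k)) :
  tens_cons A (B + C) = tens_cons A B + tens_cons A C.
Proof. by apply/matrixP=> i j; rewrite !(castmxE, mxE) mulrDr. Qed.

Lemma tens_consZl k c A (C : 'M[R]_(n ^ k)) :
  tens_cons (c *: A) C = c *: tens_cons A C.
Proof. by apply/matrixP=> i j; rewrite !(castmxE, mxE) mulrA. Qed.

Lemma tens_consZr k c A (C : 'M[R]_(n ^ k)) :
  tens_cons A (c *: C) = c *: tens_cons A C.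
Proof. by apply/matrixP=> i j; rewrite !(castmxE, mxE) mulrCA. Qed.

Lemma tens_consNr k A (C : 'M[R]_(n ^ k)) :
  tens_cons A (- C) = - tens_cons A C.
Proof. by rewrite -!scaleN1r tens_consZr. Qed.

Lemma tens_cons0 k A : tens_cons A (0 : 'M[R]_(n ^ k)) = 0.
Proof. by rewrite -(scale0r 0) tens_consZr scale0r. Qed.

Lemma tens_cons_sumr k A (I : Type) (r : seq I) (P : pred I)
    (F : I -> 'M[R]_(n ^ k)) :
  tens_cons A (\sum_(i <- r | P i) F i) = \sum_(i <- r | P i) tens_cons A (F i).
Proof. exact: (big_morph _ (tens_consDr A) (tens_cons0 k A)). Qed.

(** A first factor equal to A leaves the whole word Y to be placed in the other
  factors; otherwise it is the first letter of Y.  The value is 0 when Y has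
  more than k letters. *)
Fixpoint tens_shuffle A k {m : nat} {struct k} :
    ('I_m -> 'M[R]_n) -> 'M[R]_(n ^ k) :=
  match k with
  | 0 => fun _ => if m is 0 then 1%:M else 0
  | k'.+1 => fun Y => tens_cons A (tens_shuffle A k' Y) +
      match m return ('I_m -> 'M[R]_n) -> 'M[R]_(n ^ k'.+1) with
      | 0 => fun _ => 0
      | m'.+1 => fun Y =>
         tens_cons (Y ord0) (tens_shuffle A k' (arg_tail Y))
      end Y
  end.

Lemma tens_shuffle_nil A k (Y : 'I_0 -> 'M[R]_n) : tens_shuffle A k Y = A ^t k.
Proof.
elim: k => //= k ->; rewrite addr0; apply: pack_inj.
by rewrite pack_tens_cons -pack_ntensmxS.
Qed.

Lemma tens_shuffle_linear A k m p (Y : 'I_m -> 'M[R]_n) :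
  linear (fun v => tens_shuffle A k (arg_insert p v Y)).
Proof.
move=> c u v; elim: k m p Y => [|k IH] m p Y /=; first by rewrite scaler0 addr0.
rewrite IH tens_consDr tens_consZr scalerDr [RHS]addrACA; congr (_ + _).
case: (unliftP ord0 p) => [q|] ->.
  case: m q Y {p} => [[]//|m] q Y.
  by rewrite !arg_insertS0 !arg_tail_insertS IH tens_consDr tens_consZr.
by rewrite !arg_insert0 !arg_tail_insert0 tens_consDl tens_consZl.
Qed.

(** The differential of A |-> tens_shuffle A k Y in the direction h: replacing
  one of the factors A of a shuffle of Y by h yields a shuffle of Y with h
  inserted. *)
Definition tens_shuffle_diff A k m h (Y : 'I_m -> 'M[R]_n) :=
  \sum_(p < m.+1) tens_shuffle A k (arg_insert p h Y).

(** The Leibniz rule for the recursion of tens_shuffle.  Inserting h in front of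
  Y accounts for the first summand; inserting it further on keeps Y_0 in front,
  whence the last one. *)
Lemma tens_shuffle_diffS A k m h (Y : 'I_m -> 'M[R]_n) :
  tens_shuffle_diff A k.+1 h Y =
  tens_cons h (tens_shuffle A k Y) + tens_cons A (tens_shuffle_diff A k h Y) +
  match m return ('I_m -> 'M[R]_n) -> 'M[R]_(n ^ k.+1) with
  | 0 => fun _ => 0
  | m'.+1 => fun Y =>
     tens_cons (Y ord0) (tens_shuffle_diff A k h (arg_tail Y))
  end Y.
Proof.
rewrite /tens_shuffle_diff /= big_split /= -tens_cons_sumr.
rewrite -[RHS]addrA [RHS]addrCA; congr (_ + _).
rewrite big_ord_recl arg_insert0 arg_tail_insert0; congr (_ + _).
case: m Y => [|m] Y; first by rewrite big_ord0.
rewrite tens_cons_sumr; apply: eq_bigr => p _.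
by rewrite arg_insertS0 arg_tail_insertS.
Qed.

Definition tens_shuffle_rem A k m h (Y : 'I_m -> 'M[R]_n) :=
  tens_shuffle (A + h) k Y - tens_shuffle A k Y - tens_shuffle_diff A k h Y.

(** Up to remainders for k, only h (x) tens_shuffle_diff A k h Y is left, which is
  of second order in h. *)
Lemma tens_shuffle_remS A k m h (Y : 'I_m -> 'M[R]_n) :
  tens_shuffle_rem A k.+1 h Y = tens_cons A (tens_shuffle_rem A k h Y) +
    tens_cons h (tens_shuffle_rem A k h Y + tens_shuffle_diff A k h Y) +
  match m return ('I_m -> 'M[R]_n) -> 'M[R]_(n ^ k.+1) with
  | 0 => fun _ => 0
  | m'.+1 => fun Y => tens_cons (Y ord0) (tens_shuffle_rem A k h (arg_tail Y))
  end Y.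
Proof.
rewrite /tens_shuffle_rem subrK tens_shuffle_diffS /= tens_consDl.
case: m Y => [|m] Y; rewrite !tens_consDr !tens_consNr;
  by apply/matrixP=> i j; rewrite !mxE; ring.
Qed.

End Shuffle.

(** * Shuffles and compositions *)

Section Interleave.
Variables (R : comPzRingType) (n : nat).
Implicit Types A B : 'M[R]_n.

Lemma pack_interleave k m A (j : 'I_m.+1 -> nat) (Y : 'I_m -> 'M[R]_n) :
  (\sum_i j i + m)%N = k -> pack (interleave k A j Y) = pack (interleave_rec A j Y).
Proof.
move=> jk; have E : interleave_dim n j = (n ^ k)%N by rewrite interleave_dimE jk.
by rewrite (interleave_conformE _ _ E) pack_castmx.
Qed.

Lemma pack_interleave_recS m A (j : 'I_m.+2 -> nat) (Y : 'I_m.+1 -> 'M[R]_n) :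
  pack (interleave_rec A j Y) = ptens (pack (A ^t j ord0))
    (ptens (pack (Y ord0)) (pack (interleave_rec A (arg_tail j) (arg_tail Y)))).
Proof. by []. Qed.

Lemma interleave_succ k m A (i j : 'I_m.+1 -> nat) (Y : 'I_m -> 'M[R]_n) :
  i ord0 = (j ord0).+1 -> arg_tail i = arg_tail j -> (\sum_i j i + m)%N = k ->
  interleave k.+1 A i Y = tens_cons A (interleave k A j Y).
Proof.
move=> i0 it jk; apply: pack_inj; rewrite pack_tens_cons !pack_interleave //.
  case: m i j Y i0 it {jk} => [|m] i j Y i0 it.
    by rewrite /= i0 pack_ntensmxS.
  by rewrite !pack_interleave_recS i0 it pack_ntensmxS !ptensA.
rewrite -jk big_ord_recl i0 [in RHS]big_ord_recl !addSn; congr (_ + _ + _).+1.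
by apply: eq_bigr => l _; move/(congr1 (@^~ l)): it.
Qed.

Lemma interleave_zero k m A (j : 'I_m.+2 -> nat) (Y : 'I_m.+1 -> 'M[R]_n) :
  j ord0 = 0%N -> (\sum_i arg_tail j i + m)%N = k ->
  interleave k.+1 A j Y =
  tens_cons (Y ord0) (interleave k A (arg_tail j) (arg_tail Y)).
Proof.
move=> j0 jk; apply: pack_inj; rewrite pack_tens_cons !pack_interleave //.
  by rewrite pack_interleave_recS j0 ptens1l.
by rewrite big_ord_recl j0 addnS jk.
Qed.

(** The sum ranges over all compositions of k - m in m + 1 parts, because parts
  bounded by N with k <= N + m are in fact unrestricted.  Having N apart from k
  keeps the index type fixed in the induction on k.  Tuples with positive first
  part correspond, by decreasing it, to tuples for k and the same word, and
  tuples with first part 0, by dropping it, to tuples for k and the word without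
  its first letter. *)
Lemma sum_interleave N k m A (Y : 'I_m -> 'M[R]_n) : (k <= N + m)%N ->
  \sum_(j : {ffun 'I_m.+1 -> 'I_N.+1} | (\sum_i (j i : nat) + m == k)%N)
     interleave k A (fun i => j i : nat) Y = tens_shuffle A k Y.
Proof.
elim: k m Y => [|k IH] m Y kN.
  case: m Y {kN} => [|m] Y /=; last first.
    by rewrite big_pred0 // => j; rewrite addnS.
  rewrite (big_pred1 [ffun=> ord0]) => [|j].
    by rewrite /interleave /= ffunE; exact: conform_mx_id.
  rewrite big_ord1 addn0; apply/idP/eqP => [/eqP j0|->]; last by rewrite ffunE.
  by apply/ffunP => i; rewrite ffunE ord1; apply: val_inj.
rewrite (bigID (fun j : {ffun 'I_m.+1 -> 'I_N.+1} => j ord0 != ord0)) /=.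
congr (_ + _).
  pose up (j : {ffun 'I_m.+1 -> 'I_N.+1}) : {ffun 'I_m.+1 -> 'I_N.+1} :=
    [ffun i => if i == ord0 then inord (j ord0).+1 else j i].
  pose down (j : {ffun 'I_m.+1 -> 'I_N.+1}) : {ffun 'I_m.+1 -> 'I_N.+1} :=
    [ffun i => if i == ord0 then inord (j ord0).-1 else j i].
  have upS (j : {ffun 'I_m.+1 -> 'I_N.+1}) : (j ord0 < N)%N ->
      (\sum_i (up j i : nat) = (\sum_i (j i : nat)).+1)%N.
    move=> jN; rewrite big_ord_recl ffunE eqxx inordK //.
    by rewrite [in RHS]big_ord_recl addSn; under eq_bigr do rewrite ffunE.
  rewrite -IH; last lia.
  rewrite tens_cons_sumr (reindex_onto up down) /=; last first.
    move=> j /andP[_ j0]; apply/ffunP => i; rewrite !ffunE; case: eqP => // ->.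
    have {}j0 : (0 < j ord0)%N by rewrite lt0n.
    have jN : ((j ord0).-1 < N.+1)%N by rewrite (leq_ltn_trans (leq_pred _)).
    by apply: val_inj; rewrite eqxx /= (inordK jN) prednK // inordK.
  have jN (j : {ffun 'I_m.+1 -> 'I_N.+1}) : (\sum_i (j i : nat) + m == k)%N ->
      (j ord0 < N)%N.
    by rewrite big_ord_recl => /eqP jk; lia.
  have upP (j : {ffun 'I_m.+1 -> 'I_N.+1}) :
      ((\sum_i (up j i : nat) + m == k.+1) && (up j ord0 != ord0)
        && (down (up j) == j) = (\sum_i (j i : nat) + m == k))%N.
    rewrite !ffunE eqxx; apply/andP/idP => [[/andP[jk up0] _]|jk].
      (* For j ord0 = N, the successor overflows in inord, so that it is ord0. *)
      have j0N : (j ord0 < N)%N.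
        move: up0; apply: contraNltn => Nj; rewrite /inord /insubd insubN //.
        by rewrite -leqNgt.
      by move: jk; rewrite upS.
    rewrite upS ?jN // addSn eqSS jk -val_eqE /= inordK ?ltnS ?jN //; split=> //.
    apply/eqP/ffunP => i; rewrite !ffunE; case: eqP => // ->.
    by apply: val_inj; rewrite eqxx !inordK /= ?inordK // ltnS ?jN // ltnW ?jN.
  apply: eq_big => [j|j]; rewrite upP //.
  move=> jk; apply: interleave_succ; last exact/eqP.
    by rewrite ffunE eqxx inordK // ltnS jN.
  by apply/funext => l; rewrite /arg_tail ffunE.
case: m Y kN => [|m] Y kN.
  apply: big_pred0 => j; rewrite big_ord1 addn0 negbK.
  by apply/andP => -[/eqP jk /eqP j0]; rewrite j0 in jk.
rewrite -IH; last by rewrite addnS in kN.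
pose cons0 (j : {ffun 'I_m.+1 -> 'I_N.+1}) : {ffun 'I_m.+2 -> 'I_N.+1} :=
  [ffun i => arg_insert ord0 ord0 j i].
pose tail (j : {ffun 'I_m.+2 -> 'I_N.+1}) : {ffun 'I_m.+1 -> 'I_N.+1} :=
  [ffun i => arg_tail j i].
rewrite tens_cons_sumr (reindex_onto cons0 tail) /=; last first.
  move=> j /andP[_ /negPn/eqP j0]; apply/ffunP => i; rewrite !ffunE /arg_insert.
  by case: unliftP => [l ->|->]; rewrite ?ffunE.
have cons0S (j : {ffun 'I_m.+1 -> 'I_N.+1}) (l : 'I_m.+1) :
    cons0 j (lift ord0 l) = j l.
  by rewrite ffunE -[LHS]/(arg_tail _ l) arg_tail_insert0.
have cons00 (j : {ffun 'I_m.+1 -> 'I_N.+1}) : cons0 j ord0 = ord0.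
  by rewrite ffunE arg_insert0.
have tailP (j : {ffun 'I_m.+1 -> 'I_N.+1}) :
    ((\sum_i (cons0 j i : nat) + m.+1 == k.+1) && ~~ (cons0 j ord0 != ord0)
      && (tail (cons0 j) == j) = (\sum_i (j i : nat) + m == k))%N.
  rewrite cons00 eqxx andbT big_ord_recl cons00 addnS eqSS add0n.
  rewrite (eq_bigr (fun l => j l : nat)) => [|l _]; last by rewrite cons0S.
  have -> : tail (cons0 j) = j by apply/ffunP => l; rewrite ffunE; exact: cons0S.
  by rewrite eqxx andbT.
apply: eq_big => [j|j]; rewrite tailP // => /eqP jk.
have tE : arg_tail (fun i => cons0 j i : nat) = (fun i => j i : nat).
  by apply/funext => l; rewrite /arg_tail cons0S.
rewrite interleave_zero ?cons00 // tE //.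
Qed.
End Interleave.

(** * The derivatives of the tensor power *)

Section Norm.
Variables (K : numFieldType) (n : nat).

Lemma normr_mx_entry p q (M : 'M[K]_(p, q)) i j : `|M i j| <= `|M|.
Proof.
rewrite [leRHS]/Num.norm /= mx_normE -[leLHS]nngE num_le.
exact: (le_bigmax _ (fun ij : 'I_p * 'I_q => `|M ij.1 ij.2|%:nng) (i, j)).
Qed.

Lemma normr_mx_le p q (M : 'M[K]_(p, q)) (c : K) :
  0 <= c -> (forall i j, `|M i j| <= c) -> `|M| <= c.
Proof.
move=> /nonnegP[{}c] Mc; rewrite /Num.norm /= mx_normE num_le.
by apply/bigmax_leP; split=> [|[i j] _]; rewrite -num_le /=.
Qed.

Lemma normr_tens_cons k (B : 'M[K]_n) (C : 'M[K]_(n ^ k)) :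
  `|tens_cons B C| <= `|B| * `|C|.
Proof.
apply: normr_mx_le => [|i j]; first by rewrite mulr_ge0.
by rewrite castmxE mxE normrM ler_pM ?normr_mx_entry.
Qed.

Lemma prod_arg_insert m p h (Y : 'I_m -> 'M[K]_n) :
  \prod_(i < m.+1) `|arg_insert p h Y i| = `|h| * \prod_(i < m) `|Y i|.
Proof.
rewrite (bigD1_ord p) //= /arg_insert unlift_none; congr (_ * _).
by apply: eq_bigr => i _; rewrite liftK.
Qed.

Lemma prod_arg_tail m (Y : 'I_m.+1 -> 'M[K]_n) :
  \prod_(i < m.+1) `|Y i| = `|Y ord0| * \prod_(i < m) `|arg_tail Y i|.
Proof. exact: big_ord_recl. Qed.

Lemma prod_normr_ge0 m (Y : 'I_m -> 'M[K]_n) : 0 <= \prod_(i < m) `|Y i|.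
Proof. by rewrite prodr_ge0. Qed.

Lemma normr_tens_shuffle (A : 'M[K]_n) k m (Y : 'I_m -> 'M[K]_n) :
  `|tens_shuffle A k Y| <= (`|A| + 1) ^+ k * \prod_(i < m) `|Y i|.
Proof.
have A0 : 0 <= `|A| + 1 by rewrite addr_ge0.
elim: k m Y => [|k IH] m Y /=.
  case: m Y => [|m] Y; last by rewrite normr0 mulr_ge0 // prod_normr_ge0.
  rewrite big_ord0 mulr1; apply: normr_mx_le => // i j.
  by rewrite !ord1 mxE normr1.
rewrite exprS mulrDl mul1r mulrDl; apply: le_trans (ler_normD _ _) _.
apply: lerD.
  apply: le_trans (normr_tens_cons _ _) _.
  by rewrite -mulrA ler_wpM2l.
case: m Y => [|m] Y; first by rewrite normr0 mulr_ge0 ?prod_normr_ge0 // exprn_ge0.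
apply: le_trans (normr_tens_cons _ _) _.
by rewrite prod_arg_tail mulrCA ler_wpM2l.
Qed.

Lemma normr_tens_shuffle_diff (A : 'M[K]_n) k m h (Y : 'I_m -> 'M[K]_n) :
  `|tens_shuffle_diff A k h Y| <=
    (`|A| + 1) ^+ k *+ m.+1 * `|h| * \prod_(i < m) `|Y i|.
Proof.
apply: le_trans (ler_norm_sum _ _ _) _.
apply: le_trans (ler_sum _ (fun p _ => normr_tens_shuffle _ _ _)) _.
under eq_bigr => p _ do rewrite prod_arg_insert.
by rewrite sumr_const card_ord !mulrA !mulrnAl.
Qed.

(** The bound C may depend on A, k and m but not on Y: this uniformity is what
  allows passing from pointwise to Frechet differentiability of a map with
  values in multilinear maps. *)
Lemma normr_tens_shuffle_rem (A : 'M[K]_n) k m :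
  exists2 C : K, 0 <= C & forall h (Y : 'I_m -> 'M[K]_n), `|h| <= 1 ->
    `|tens_shuffle_rem A k h Y| <= C * `|h| ^+ 2 * \prod_(i < m) `|Y i|.
Proof.
elim: k m => [|k IH] m.
  exists 0 => // h Y _; rewrite !mul0r /tens_shuffle_rem /tens_shuffle_diff.
  by rewrite /= big1 // !subrr normr0.
have [C C0 CP] := IH m.
pose D := (`|A| + 1) ^+ k *+ m.+1.
have D0 : 0 <= D by rewrite mulrn_wge0 // exprn_ge0 // addr_ge0.
(* E bounds the last summand of tens_shuffle_remS, which exists only if m > 0. *)
have [E E0 EP] : exists2 E : K, 0 <= E & forall h (Y : 'I_m -> 'M[K]_n),
    `|h| <= 1 ->
  `|match m return ('I_m -> 'M[K]_n) -> 'M[K]_(n ^ k.+1) with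
  | 0 => fun _ => 0
  | m'.+1 => fun Y => tens_cons (Y ord0) (tens_shuffle_rem A k h (arg_tail Y))
  end Y| <= E * `|h| ^+ 2 * \prod_(i < m) `|Y i|.
  clear -IH; case: m => [|m]; first by exists 0 => // h Y _; rewrite !mul0r normr0.
  have [E E0 EP] := IH m; exists E => // h Y h1.
  apply: le_trans (normr_tens_cons _ _) _.
  by rewrite prod_arg_tail mulrCA ler_wpM2l // EP.
exists (`|A| * C + (C + D) + E) => [|h Y h1].
  by rewrite !addr_ge0 // mulr_ge0.
have P0 := prod_normr_ge0 Y.
rewrite tens_shuffle_remS mulrDl mulrDl; apply: le_trans (ler_normD _ _) _.
apply: lerD (EP _ _ h1); apply: le_trans (ler_normD _ _) _.
rewrite mulrDl mulrDl; apply: lerD.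
  apply: le_trans (normr_tens_cons _ _) _.
  by rewrite -2!(mulrA `|A|); apply: ler_wpM2l => //; exact: CP.
apply: le_trans (normr_tens_cons _ _) _.
rewrite expr2 mulrCA -!mulrA ler_wpM2l // mulrDl.
apply: le_trans (ler_normD _ _) _; apply: lerD.
  apply: le_trans (CP _ _ h1) _; rewrite -mulrA ler_wpM2l // ler_wpM2r //.
  (* A remainder of order |h|^2 multiplied by |h| is still of order |h|^2. *)
  by rewrite expr2 ler_piMl.
by rewrite mulrA; exact: normr_tens_shuffle_diff.
Qed.

Definition tens_sym_shuffle (A : 'M[K]_n) k m (X : 'I_m -> 'M[K]_n) :=
  \sum_(s : 'S_m) tens_shuffle A k (X \o s).

Lemma prod_perm m (X : 'I_m -> 'M[K]_n) (s : 'S_m) :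
  \prod_(i < m) `|(X \o s) i| = \prod_(i < m) `|X i|.
Proof. by rewrite [RHS](reindex_inj (@perm_inj _ s)). Qed.

Lemma tens_sym_shuffle_multilinear (A : 'M[K]_n) k m :
  @continuous_multilinear K 'M[K]_n 'M[K]_(n ^ k) m (tens_sym_shuffle A k (m := m)).
Proof.
split=> [X i c u v|].
  rewrite /tens_sym_shuffle scaler_sumr -big_split; apply: eq_bigr => s _ /=.
  rewrite !dfwith_perm; case: m X i s => [_ []//|m] X i s.
  by rewrite !dfwith_insert tens_shuffle_linear.
exists ((`|A| + 1) ^+ k *+ #|'S_m|) => X.
apply: le_trans (ler_norm_sum _ _ _) _.
apply: le_trans (ler_sum _ (fun s _ => normr_tens_shuffle _ _ _)) _.
under eq_bigr => p _ do rewrite prod_perm.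
by rewrite sumr_const mulrnAl.
Qed.

Lemma tens_sym_shuffle_derivative (A : 'M[K]_n) k m :
  @is_multilinear_derivative K 'M[K]_n 'M[K]_(n ^ k) m
    (fun B => tens_sym_shuffle B k (m := m)) A (tens_sym_shuffle A k (m := m.+1)).
Proof.
split=> [|e e0]; first exact: tens_sym_shuffle_multilinear.
have [C C0 CP] := normr_tens_shuffle_rem A k m.
(* The remainders of the m! arrangements add up; + 1 makes D invertible. *)
pose D := C *+ #|'S_m| + 1.
have D0 : 0 < D by rewrite ltr_wpDl // mulrn_wge0.
have n1 : \forall h \near (0 : 'M[K]_n), `|h| <= 1.
  by apply: nbhs0_le.
have n2 : \forall h \near (0 : 'M[K]_n), `|h| <= e / D.
  by apply: nbhs0_le; rewrite divr_gt0.
apply: filterS2 n1 n2 => h h1 he X.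
have -> : tens_sym_shuffle (A + h) k X - tens_sym_shuffle A k X
    - tens_sym_shuffle A k (arg_cons h X)
    = \sum_(s : 'S_m) tens_shuffle_rem A k h (X \o s).
  rewrite {3}/tens_sym_shuffle -[arg_cons h X]/(arg_insert ord0 h X) sum_perm_insert.
  by rewrite -!sumrB.
apply: le_trans (ler_norm_sum _ _ _) _.
apply: le_trans (ler_sum _ (fun s _ => CP _ _ h1)) _.
under eq_bigr => p _ do rewrite prod_perm.
rewrite sumr_const -!mulrnAl ler_wpM2r ?prod_normr_ge0 // expr2 mulrA.
rewrite ler_wpM2r //; apply: (@le_trans _ _ (D * `|h|)).
  by rewrite ler_wpM2r // lerDl.
by rewrite mulrC -ler_pdivlMr.
Qed.

Lemma tens_power_is_nth_derivative k m (A : 'M[K]_n) :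
  is_nth_derivative (@tensor_power K n k : 'M[K]_n -> 'M[K]_(n ^ k)) A
    (tens_sym_shuffle A k (m := m)).
Proof.
elim: m A => [|m IH] A /=.
  move=> X; rewrite /tens_sym_shuffle (big_pred1 1%g) ?tens_shuffle_nil // => s.
  by apply/esym/eqP/permP => -[].
exists (fun B => tens_sym_shuffle B k (m := m)); split.
  by near do exact: IH.
exact: tens_sym_shuffle_derivative.
Unshelve. all: by end_near. Qed.
End Norm.

Theorem theorem4p1 (R : realType) (n k : nat) (hn : (1 <= n)%N)
  (hk : (1 <= k)%N) (A : 'M[R[i]]_n) (m : nat) (hm : (1 <= m <= k)%N)
  (X : 'I_m -> 'M[R[i]]_n) :
  nth_differentiable m (@tensor_power R[i] n k) A /\
  nth_derivative (@tensor_power R[i] n k) A X =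
    \sum_(s : 'S_m)
      \sum_(j : {ffun 'I_m.+1 -> 'I_(k - m).+1}
              | (\sum_(i < m.+1) (j i : nat) == k - m)%N)
        interleave k A (fun i : 'I_m.+1 => j i : nat) (fun i : 'I_m => X (s i)).
Proof.
have /andP[_ mk] := hm.
have dA := @tens_power_is_nth_derivative R[i] n k m A.
split; first by exists (tens_sym_shuffle A k (m := m)).
have -> : nth_derivative (@tensor_power R[i] n k) A = tens_sym_shuffle A k (m := m).
  apply: is_nth_derivative_unique (dA).
  exact: (@getPex _ (fun L => is_nth_derivative _ A L) (ex_intro _ _ dA)).
apply: eq_bigr => s _; rewrite -(@sum_interleave _ _ (k - m)) ?subnK //.
by apply: eq_bigl => j; rewrite -(eqn_add2r m _ (k - m)) subnK.
Qed.
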